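(* For every integer $k\ge 1$, there are only finitely many $k$-vertex-critical $(2P_2,claw+P_1)$-free graphs.
   Context: Graphs are finite and simple, and ''finitely many'' means up to isomorphism. A graph $G$ is $k$-vertex-critical if $\chi(G)=k$ and $\chi(G-v)<k$ for all $v\in V(G)$, where $\chi$ denotes the chromatic number. A graph is $(H_1,H_2)$-free if it contains no induced subgraph isomorphic to $H_1$ or $H_2$. $2P_2$ is the disjoint union of two edges. The $claw$ is $K_{1,3}$, and $claw+P_1$ is the disjoint union of a claw and an isolated vertex. *)

(* Defs.v *)
From mathcomp Require Import all_boot.

Set Implicit Arguments.
Unset Strict Implicit.
Unset Printing Implicit Defensive.

Record sgraph := SGraph {
  vertex :> finType;
  adj : rel vertex;
  adj_sym : symmetric adj;
  adj_irr : irreflexive adj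
}.

Definition isomorphic (G H : sgraph) : Prop :=
  exists f : G -> H, bijective f /\ forall x y, adj (f x) (f y) = adj x y.

Section Induced.
Variables (G : sgraph) (S : {set G}).

Definition induced_adj : rel {x : G | x \in S} :=
  fun x y => adj (val x) (val y).

Lemma induced_adj_sym : symmetric induced_adj.
Proof. by move=> x y; rewrite /induced_adj adj_sym. Qed.

Lemma induced_adj_irr : irreflexive induced_adj.
Proof. by move=> x; rewrite /induced_adj adj_irr. Qed.

Definition induced : sgraph := SGraph induced_adj_sym induced_adj_irr.
End Induced.

Definition del_vertex (G : sgraph) (v : G) : sgraph := induced [set~ v].

Definition induced_free (H G : sgraph) : Prop :=
  ~ exists S : {set G}, isomorphic (induced S) H.

Definition proper_coloring (G : sgraph) (k : nat) (c : {ffun G -> 'I_k}) : bool :=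
  [forall x, forall y, adj x y ==> (c x != c y)].

Definition colorable (G : sgraph) (k : nat) : bool :=
  [exists c : {ffun G -> 'I_k}, proper_coloring c].

Lemma ex_colorable (G : sgraph) : exists k, colorable G k.
Proof.
exists #|G|; apply/existsP; exists [ffun x => enum_rank x].
apply/forallP => x; apply/forallP => y; apply/implyP => xy.
rewrite !ffunE (inj_eq enum_rank_inj).
by apply: contraTneq xy => ->; rewrite adj_irr.
Qed.

Definition chromatic_number (G : sgraph) : nat := ex_minn (ex_colorable G).

Definition vertex_critical (k : nat) (G : sgraph) : Prop :=
  chromatic_number G = k /\ forall v : G, chromatic_number (del_vertex v) < k.

Section DisjointUnion.
Variables G H : sgraph.

Definition union_adj : rel (G + H)%type := fun x y =>
  match x, y with
  | inl a, inl b => adj a b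
  | inr a, inr b => adj a b
  | _, _ => false
  end.

Lemma union_adj_sym : symmetric union_adj.
Proof. by move=> [x|x] [y|y] //=; rewrite adj_sym. Qed.

Lemma union_adj_irr : irreflexive union_adj.
Proof. by move=> [x|x] /=; rewrite adj_irr. Qed.

Definition disjoint_union : sgraph := SGraph union_adj_sym union_adj_irr.
End DisjointUnion.

Section Path.
Variable n : nat.

Definition path_adj : rel 'I_n := fun i j => (i.+1 == j) || (j.+1 == i).

Lemma path_adj_sym : symmetric path_adj.
Proof. by move=> i j; rewrite /path_adj orbC. Qed.

Lemma path_adj_irr : irreflexive path_adj.
Proof. by move=> i; rewrite /path_adj orbb gtn_eqF. Qed.

(* [n] counts vertices, not edges. *)
Definition path_graph : sgraph := SGraph path_adj_sym path_adj_irr.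
End Path.

Section CompleteBipartite.
Variables m n : nat.

Definition bipartite_adj : rel ('I_m + 'I_n)%type := fun x y =>
  match x, y with
  | inl _, inr _ | inr _, inl _ => true
  | _, _ => false
  end.

Lemma bipartite_adj_sym : symmetric bipartite_adj.
Proof. by move=> [x|x] [y|y]. Qed.

Lemma bipartite_adj_irr : irreflexive bipartite_adj.
Proof. by move=> [x|x]. Qed.

Definition complete_bipartite : sgraph :=
  SGraph bipartite_adj_sym bipartite_adj_irr.
End CompleteBipartite.

Definition two_P2 : sgraph := disjoint_union (path_graph 2) (path_graph 2).
Definition claw : sgraph := complete_bipartite 1 3.
Definition claw_plus_P1 : sgraph := disjoint_union claw (path_graph 1).

Definition finitely_many (P : sgraph -> Prop) : Prop :=
  exists (n : nat) (L : 'I_n -> sgraph),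
    forall G : sgraph, P G -> exists i : 'I_n, isomorphic G (L i).

(* Main.v *)
(** Color [G] with [k] colors and let [S] be a color class.  Since [claw + P1]
    is excluded, a vertex with three neighbours in [S] is complete to [S].
    In a vertex-critical graph no neighbourhood contains another one, so all
    vertices of [S] but at most one have a neighbour with at most two neighbours
    in [S].  Take a minimal set [C] of such neighbours dominating these vertices
    of [S]: each member of [C] has a private neighbour in [S], so [C] is a clique
    because [2P2] is excluded.  Hence [#|C| <= k], [#|S| <= 2k + 1], and
    [#|G| <= k (2k + 1)]. *)
Require Import Defs.
From mathcomp Require Import all_boot.

Set Implicit Arguments.
Unset Strict Implicit.
Unset Printing Implicit Defensive.

Section BoundedOrder.
Variable N : nat.

(** An order [m <= N] with an [m] by [m] Boolean matrix. There are finitely many such codes, and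
    they index the list of graphs. *)
Let code := {m : 'I_N.+1 & {ffun 'I_m * 'I_m -> bool}}.

(** Dropping the diagonal and symmetrising make every matrix define a graph; an adjacency matrix is
    left unchanged. *)
Let code_adj (t : code) : rel 'I_(tag t) :=
  fun i j => (i != j) && (tagged t (i, j) || tagged t (j, i)).

Let code_adj_sym t : symmetric (@code_adj t).
Proof. by move=> i j; rewrite /code_adj eq_sym orbC. Qed.

Let code_adj_irr t : irreflexive (@code_adj t).
Proof. by move=> i; rewrite /code_adj eqxx. Qed.

Lemma finitely_many_bounded_order (P : sgraph -> Prop) :
  (forall G : sgraph, P G -> #|G| <= N) -> finitely_many P.
Proof.
move=> leN.
exists #|{: code}|, (fun i => SGraph (@code_adj_sym (enum_val i))
                                     (@code_adj_irr (enum_val i))).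
move=> G /leN; rewrite -ltnS => ltN.
pose m := Ordinal ltN.
pose e : {ffun 'I_m * 'I_m -> bool} :=
  [ffun p => adj (enum_val p.1 : G) (enum_val p.2)].
pose t : code := Tagged (fun m : 'I_N.+1 => {ffun 'I_m * 'I_m -> bool}) e.
exists (enum_rank t); rewrite enum_rankK.
exists (fun x : G => enum_rank x : 'I_(tag t)); split.
  exact: enum_rank_bij.
move=> x y; rewrite /= /code_adj /= !ffunE /= !enum_rankK (adj_sym y x) orbb.
rewrite (inj_eq enum_rank_inj).
by case: eqVneq => // ->; rewrite adj_irr.
Qed.

End BoundedOrder.

Lemma induced_free_embedding (H G : sgraph) (f : H -> G) :
  induced_free H G -> injective f -> ~ (forall x y, adj (f x) (f y) = adj x y).
Proof.
move=> freeG f_inj f_adj; apply: freeG; exists [set f x | x in H].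
have fS x : f x \in [set f x | x in H] by apply: imset_f.
pose g x : induced [set f x | x in H] := exist _ (f x) (fS x).
have g_inj : injective g by move=> x y /(congr1 val); apply: f_inj.
have [|h gK hK] := inj_card_bij g_inj.
  by rewrite card_sig card_imset.
exists h; split; first by exists g.
move=> x y; rewrite -[in RHS](hK x) -[in RHS](hK y).
by rewrite -f_adj.
Qed.

(** Otherwise [ab] and [cd] would induce a [2P2]. Distinctness of the four vertices follows from the
    adjacencies and need not be assumed. *)
Lemma two_P2_free_adj (G : sgraph) (a b c d : G) :
  induced_free two_P2 G -> adj a b -> adj c d ->
  ~~ adj a c -> ~~ adj a d -> ~~ adj b c -> adj b d.
Proof.
move=> freeG ab cd ac ad bc; apply/negPn/negP => bd.
pose f (x : two_P2) : G := match x with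
  | inl i => if val i == 0 then a else b
  | inr i => if val i == 0 then c else d
  end.
have f_adj x y : adj (f x) (f y) = adj x y.
  have [ba dc] : adj b a /\ adj d c by rewrite ![adj _ a]adj_sym ![adj _ c]adj_sym.
  move: (ac) (ad) (bc) (bd); rewrite ![adj a _]adj_sym ![adj b _]adj_sym.
  move: ac ad bc bd => /negbTE ac /negbTE ad /negbTE bc /negbTE bd.
  move=> /negbTE ca /negbTE da /negbTE cb /negbTE db.
  case: x y => [] [[|[|i]] hi] [] [[|[|j]] hj] //=; rewrite ?adj_irr //.
apply: (induced_free_embedding freeG _ f_adj) => x y fxy.
(* Every vertex of [2P2] is the only neighbour of its mate. *)
have nbr z : adj x z = adj y z by rewrite -!f_adj fxy.
pose o0 : 'I_2 := ord0; pose o1 : 'I_2 := ord_max.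
move: (nbr (inl o0)) (nbr (inl o1)) (nbr (inr o0)) (nbr (inr o1)).
case: x y {fxy nbr} => [] [[|[|i]] hi] [] [[|[|j]] hj] //= _ _ _ _.
all: by congr (_ _); apply: val_inj.
Qed.

(** A non-neighbour [d] of [x] in [S] would be isolated from the claw formed by [x] and three of its
    neighbours in [S]. *)
Lemma claw_free_complete (G : sgraph) (S : {set G}) (x : G) :
  induced_free claw_plus_P1 G -> {in S &, forall u v, ~~ adj u v} ->
  2 < #|[set u in S | adj x u]| -> {in S, forall u, adj x u}.
Proof.
move=> freeG indS /card_gt2P[a [b [c [[]]]]]; rewrite !inE.
move=> /andP[aS xa] /andP[bS xb] /andP[cS xc] [ab bc ca] d dS.
apply/negPn/negP => xd.
pose f (z : claw_plus_P1) : G := match z with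
  | inl (inl _) => x
  | inl (inr i) => tnth [tuple a; b; c] i
  | inr _ => d
  end.
have tS i : tnth [tuple a; b; c] i \in S by case: i => [[|[|[|i]]] hi].
have xt i : adj x (tnth [tuple a; b; c] i) by case: i => [[|[|[|i]]] hi].
have f_adj y z : adj (f y) (f z) = adj y z.
  case: y z => [[i|i]|[[|i] hi]] [[j|j]|[[|j] hj]] //=; rewrite ?adj_irr //;
    solve [ by rewrite xt | by rewrite adj_sym xt | by apply/negbTE/indS
          | by apply/negbTE | by rewrite adj_sym; apply/negbTE ].
apply: (induced_free_embedding freeG _ f_adj).
have uT : uniq [tuple a; b; c] by rewrite /= !inE negb_or ab bc eq_sym ca.
have neqS u : adj x u -> u <> d by move=> xu eq_ud; rewrite -eq_ud xu in xd.
have neqx u : u \in S -> x <> u.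
  by move=> uS eq_xu; have := indS _ _ uS aS; rewrite -eq_xu xa.
case=> [[i|i]|i] [[j|j]|j] //= E.
- by rewrite (ord1 i) (ord1 j).
- by case: (neqx _ (tS j)).
- by case: (neqx _ dS).
- by case: (neqx _ (tS i)).
- congr (inl (inr _)); apply: val_inj; apply/eqP.
  by move/eqP: E; rewrite !(tnth_nth a) nth_uniq //= ltn_ord.
- by case: (neqS _ (xt i)).
- by case: (neqx _ dS).
- by case: (neqS _ (xt j)).
- by rewrite (ord1 i) (ord1 j).
Qed.

(** A coloring of [G - u] extends to [G] by giving [u] the color of [v]: each neighbour of [u] is a
    neighbour of [v], so it already avoids this color. *)
Lemma colorable_del_vertex (G : sgraph) (m : nat) (u v : G) :
  u != v -> (forall w, adj u w -> adj v w) ->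
  colorable (del_vertex u) m -> colorable G m.
Proof.
move=> neq_uv sub_uv /existsP[c /forallP c_prop].
have vN : v \in [set~ u] by rewrite !inE eq_sym.
(* The default value of [insubd] is [v], so [r] sends [u] to [v] and fixes all other vertices. *)
pose r w : del_vertex u := insubd (exist _ v vN) w.
have rE w : val (r w) = if w == u then v else w.
  by rewrite /r val_insubd !inE; case: eqP.
apply/existsP; exists [ffun w => c (r w)].
apply/forallP => x; apply/forallP => y; apply/implyP => xy; rewrite !ffunE.
move: (forallP (c_prop (r x)) (r y)) => /implyP; apply.
rewrite /= /induced_adj !rE.
case: eqVneq xy => [->|_]; case: eqVneq => [->|_] //; rewrite ?adj_irr //.
  exact: sub_uv.
by rewrite ![adj x _]adj_sym; apply: sub_uv.
Qed.

Lemma colorable_chromatic_number (G : sgraph) :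
  colorable G (chromatic_number G).
Proof. by rewrite /chromatic_number; case: ex_minnP. Qed.

Lemma chromatic_number_le (G : sgraph) (m : nat) :
  colorable G m -> chromatic_number G <= m.
Proof. by rewrite /chromatic_number; case: ex_minnP => n _ le_n /le_n. Qed.

(** If [u] and [v] were distinct, a coloring of [G - u] with fewer than [k] colors would extend to
    [G]. *)
Lemma vertex_critical_nbhd (k : nat) (G : sgraph) (u v : G) :
  vertex_critical k G -> (forall w, adj u w -> adj v w) -> u = v.
Proof.
move=> [chiG chi_del] sub_uv; apply/eqP/negPn/negP => neq_uv.
have := colorable_del_vertex neq_uv sub_uv (colorable_chromatic_number _).
by move/chromatic_number_le; rewrite chiG leqNgt chi_del.
Qed.

Lemma card_clique_colorable (G : sgraph) (k : nat) (C : {set G}) :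
  colorable G k -> {in C &, forall x y, x != y -> adj x y} -> #|C| <= k.
Proof.
move=> /existsP[c /forallP c_prop] cliqueC.
rewrite -[k]card_ord -(card_in_imset (f := c) (D := mem C)) ?max_card //.
move=> x y xC yC cxy; apply/eqP/negPn/negP => /(cliqueC _ _ xC yC) xy.
by move: (forallP (c_prop x) y); rewrite xy cxy eqxx.
Qed.

Lemma card_independent (G : sgraph) (k : nat) (S : {set G}) :
  vertex_critical k G -> induced_free two_P2 G -> induced_free claw_plus_P1 G ->
  {in S &, forall u v, ~~ adj u v} -> #|S| <= (2 * k).+1.
Proof.
move=> critG free2P2 freeCP indS.
pose nbS x := [set u in S | adj x u].
pose cover_of (C : {set G}) := \bigcup_(x in C) nbS x.
pose T := [set x | #|nbS x| <= 2].
(* [C] is a minimal subset of [T] that dominates the same vertices of [S] as [T] does. *)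
have [C /minsetP[/eqP coverC minC] /subsetP subCT] :=
  minset_exists (P := fun C => cover_of C == cover_of T) (eqxx (cover_of T)).
have cliqueC : {in C &, forall x y, x != y -> adj x y}.
  have private x : x \in C -> exists2 u, u \in nbS x &
      {in C, forall y, y != x -> ~~ adj y u}.
    move=> xC.
    (* If the other members of [C] covered [nbS x], then [x] could be removed from [C], against
       minimality. *)
    have [/subsetP sub | /subsetPn[u ux uN]] :=
      boolP (nbS x \subset cover_of (C :\ x)).
      suff /minC : cover_of (C :\ x) == cover_of T.
        by move=> /(_ (subD1set _ _)) /setP/(_ x); rewrite !inE eqxx xC.
      rewrite -coverC eqEsubset; apply/andP; split; apply/subsetP => u.
        by case/bigcupP=> y /setD1P[_ yC] yu; apply/bigcupP; exists y.
      case/bigcupP=> y yC yu; have [eq_yx|neq_yx] := eqVneq y x.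
        by apply: sub; rewrite -eq_yx.
      by apply/bigcupP; exists y => //; rewrite !inE neq_yx.
    exists u => // y yC neq_yx; apply: contra uN => yu; apply/bigcupP.
    by exists y; rewrite !inE ?neq_yx //; move: ux; rewrite inE => /andP[->].
  move=> x y xC yC neq_xy.
  have [u] := private x xC; rewrite inE => /andP[uS xu] uN.
  have [v] := private y yC; rewrite inE => /andP[vS yv] vN.
  (* The edges from [x] and [y] to their private neighbours [u] and [v] can only be joined by
     [xy]. *)
  apply: (@two_P2_free_adj G u x v y) => //.
  - by rewrite adj_sym.
  - by rewrite adj_sym.
  - exact: indS.
  - by rewrite adj_sym uN // eq_sym.
  - exact: vN.
have leC : #|C| <= k.
  case: (critG) => chiG _; apply: card_clique_colorable cliqueC.
  by rewrite -chiG colorable_chromatic_number.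
have le_cover : #|cover_of C| <= 2 * #|C|.
  rewrite mulnC -sum_nat_const.
  apply: (@leq_trans (\sum_(x in C) #|nbS x|)); last first.
    by apply: leq_sum => x /subCT; rewrite inE.
  rewrite /cover_of; elim/big_rec2: _ => [|x n D _ leD]; first by rewrite cards0.
  by apply: leq_trans (leq_card_setU _ _) _; rewrite leq_add2l.
(* A neighbour [w] of an uncovered [u] lies outside [T], hence is complete to [S]. So the
   neighbourhood of [u] is contained in that of every [v] in [S], which forces [u = v]. *)
have le_rest : #|S :\: cover_of C| <= 1.
  apply/card_le1P => u; rewrite inE => /andP[uN uS] v; rewrite !inE.
  apply/idP/eqP => [/andP[vN vS]|->]; last by rewrite uN.
  apply/esym; apply: vertex_critical_nbhd critG _ => w uw.
  have wN : 2 < #|nbS w|.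
    rewrite ltnNge; apply: contra uN => wT; rewrite coverC; apply/bigcupP.
    by exists w; rewrite !inE // uS adj_sym.
  by rewrite adj_sym (claw_free_complete freeCP indS wN).
rewrite -(cardsID (cover_of C) S) -addn1 leq_add //.
apply: leq_trans (subset_leq_card (subsetIr _ _)) _.
by rewrite (leq_trans le_cover) // leq_mul2l.
Qed.

Theorem corollary4p4 (k : nat) (hk : 1 <= k) :
  finitely_many (fun G : sgraph =>
    vertex_critical k G /\ induced_free two_P2 G /\ induced_free claw_plus_P1 G).
Proof.
apply: (@finitely_many_bounded_order (k * (2 * k).+1)).
move=> G [critG [free2P2 freeCP]].
have /existsP[c /forallP c_prop] : colorable G k.
  by case: critG => <- _; apply: colorable_chromatic_number.
(* The vertices are counted by color class, each class being independent. *)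
rewrite -cardsT -sum1_card (partition_big c predT) //=.
rewrite -[X in X * _]card_ord -sum_nat_const; apply: leq_sum => i _.
rewrite sum1dep_card; apply: card_independent critG free2P2 freeCP _.
move=> u v; rewrite !inE => /eqP cu /eqP cv.
by apply/negP => uv; move: (forallP (c_prop u) v); rewrite uv cu cv eqxx.
Qed.
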